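(* For every $n \in \mathbb{N}$ (with $0 \in \mathbb{N}$), $$K_{n+2} = 2\,(J_n + 1),$$ where $K_m$ denotes the number of non-colourable strings of length $m$ over $\{0,1\}$ and $J_n = \frac{2^n - (-1)^n}{3}$ is the $n$-th Jacobsthal number.
   Context: Strings are over the alphabet $\Lambda=\{0,1\}$; $\varepsilon$ is the empty string, $\#w$ is the length of $w$, and $\Lambda^n$ is the set of strings of length $n$. For $\#w\ge 1$ let $l(w)$ be $w$ with its last letter removed and $r(w)$ be $w$ with its first letter removed. Let $T^n$ be the alternating string of length $n$ starting with $0$ (so $T^0=\varepsilon$, $T^n=T^{n-1}0$ for odd $n$ and $T^n=T^{n-1}1$ for even $n\ge 2$), and let $CT^n$ be its letterwise complement ($0\leftrightarrow 1$). Define $\xi:\Lambda^*\to\{-1,0,1\}$ recursively: $\xi(\varepsilon)=0$; $\xi(w)=1$ if $w=T^k$ for some even $k\ge 2$; $\xi(w)=-1$ if $w=CT^k$ for some even $k\ge 2$; otherwise $\xi(w)=\operatorname{sgn}(\xi(l(w))+\xi(r(w)))$. Define $\phi:\Lambda^*\to\{-1,0,1\}$ recursively: $\phi(\varepsilon)=0$; $\phi(w)=-1$ if $w=0^k$ with $k$ odd; $\phi(w)=1$ if $w=1^k$ with $k$ odd; otherwise $\phi(w)=\operatorname{sgn}(\phi(r(w))-\phi(l(w)))$. The alternating colouring function is $\psi(w)=\xi(w)^{\#w}\cdot\phi(w)$ (with $0^0=1$). A string $w$ is colourable if $\psi(w)\neq 0$. $K_n=\#\{w\in\Lambda^n:\psi(w)=0\}$.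 *)

(* Defs.v *)
From mathcomp Require Import all_boot all_order all_algebra.

Set Implicit Arguments.
Unset Strict Implicit.
Unset Printing Implicit Defensive.

Import GRing.Theory Num.Theory.
Local Open Scope ring_scope.

(* Strings over {0,1} are [seq bool], with 0 = false and 1 = true. *)

Definition lcut (w : seq bool) : seq bool := take (size w).-1 w.
Definition rcut (w : seq bool) : seq bool := behead w.

Fixpoint altT (n : nat) : seq bool :=
  if n is m.+1 then rcons (altT m) (~~ odd n) else [::].

Definition altCT (n : nat) : seq bool := map negb (altT n).

(* In the four tests below the exponent k can only be the length of the
   string; see the reflection lemmas after them. *)
Definition is_evenT (w : seq bool) : bool :=
  [&& (2 <= size w)%N, ~~ odd (size w) & w == altT (size w)].

Definition is_evenCT (w : seq bool) : bool :=
  [&& (2 <= size w)%N, ~~ odd (size w) & w == altCT (size w)].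

Definition is_odd0 (w : seq bool) : bool :=
  odd (size w) && (w == nseq (size w) false).

Definition is_odd1 (w : seq bool) : bool :=
  odd (size w) && (w == nseq (size w) true).

(* The recursions are on the length of the string, passed as first argument;
   the recursion equations are [xiE] and [phiE] below. *)
Fixpoint xi_rec (n : nat) (w : seq bool) : int :=
  if n is m.+1 then
    if is_evenT w then 1
    else if is_evenCT w then -1
    else Num.sg (xi_rec m (lcut w) + xi_rec m (rcut w))
  else 0.

Definition xi (w : seq bool) : int := xi_rec (size w) w.

Fixpoint phi_rec (n : nat) (w : seq bool) : int :=
  if n is m.+1 then
    if is_odd0 w then -1
    else if is_odd1 w then 1
    else Num.sg (phi_rec m (rcut w) - phi_rec m (lcut w))
  else 0.

Definition phi (w : seq bool) : int := phi_rec (size w) w.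

Definition psi (w : seq bool) : int := xi w ^+ size w * phi w.

Definition colourable (w : seq bool) : bool := psi w != 0.

Definition K (n : nat) : nat := #|[set w : n.-tuple bool | ~~ colourable w]|.

Definition J (n : nat) : rat := (2 ^+ n - (-1) ^+ n) / 3.

Lemma size_altT n : size (altT n) = n.
Proof. by elim: n => //= n IHn; rewrite size_rcons IHn. Qed.

Lemma size_altCT n : size (altCT n) = n.
Proof. by rewrite size_map size_altT. Qed.

Lemma is_evenTP w :
  reflect (exists k, [/\ (2 <= k)%N, ~~ odd k & w = altT k]) (is_evenT w).
Proof.
apply: (iffP and3P) => [[? ? /eqP ?]|[k [? ? ->]]]; first by exists (size w).
by rewrite size_altT.
Qed.

Lemma is_evenCTP w :
  reflect (exists k, [/\ (2 <= k)%N, ~~ odd k & w = altCT k]) (is_evenCT w).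
Proof.
apply: (iffP and3P) => [[? ? /eqP ?]|[k [? ? ->]]]; first by exists (size w).
by rewrite size_altCT.
Qed.

Lemma is_odd0P w :
  reflect (exists2 k, odd k & w = nseq k false) (is_odd0 w).
Proof.
apply: (iffP andP) => [[? /eqP ?]|[k ? ->]]; first by exists (size w).
by rewrite size_nseq.
Qed.

Lemma is_odd1P w :
  reflect (exists2 k, odd k & w = nseq k true) (is_odd1 w).
Proof.
apply: (iffP andP) => [[? /eqP ?]|[k ? ->]]; first by exists (size w).
by rewrite size_nseq.
Qed.

Lemma size_lcut w : size (lcut w) = (size w).-1.
Proof. by rewrite size_take; case: w => //= x w; rewrite ltnSn. Qed.

Lemma size_rcut w : size (rcut w) = (size w).-1.
Proof. exact: size_behead. Qed.

Lemma lcut_rcons w x : lcut (rcons w x) = w.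
Proof. by rewrite /lcut size_rcons -cats1 take_size_cat. Qed.

Lemma xi_nil : xi [::] = 0. Proof. by []. Qed.

Lemma xiE w : w != [::] ->
  xi w = if is_evenT w then 1 else if is_evenCT w then -1
         else Num.sg (xi (lcut w) + xi (rcut w)).
Proof. by case: w => // x w _; rewrite {2 3}/xi size_lcut size_rcut. Qed.

Lemma phi_nil : phi [::] = 0. Proof. by []. Qed.

Lemma phiE w : w != [::] ->
  phi w = if is_odd0 w then -1 else if is_odd1 w then 1
          else Num.sg (phi (rcut w) - phi (lcut w)).
Proof. by case: w => // x w _; rewrite {2 3}/phi size_lcut size_rcut. Qed.

(* Main.v *)
Require Import Defs.
From mathcomp Require Import all_boot all_order all_algebra.
From mathcomp Require Import zify lra.

(* Both xi and phi obey a rule for adding one letter x in front and one letter y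
   behind: if v is neither constant nor alternating, then xi (x v y) = xi v and
   phi (x v y) = - phi v, while the constant and alternating v are given by an
   explicit formula. So, reading a word from its centre outwards, only the first
   pair of letters at which the central run fails to extend on both sides
   matters. A word of length at least 1 is non-colourable iff xi vanishes on it,
   i.e. iff its central run (constant, or alternating of odd length) breaks on
   both sides simultaneously or fills the word. Counting the pairs (x, y) gives
   K (m+2) = 4 K m - 2 S m, where S m is the number of constant or (for odd m)
   alternating words of length m, and J satisfies the matching recurrence
   J (n+2) = 4 J n + (-1)^n. *)

Import GRing.Theory Num.Theory.
Local Open Scope ring_scope.

(** * Constant and alternating words *)

(* [run false w]: w is constant; [run true w]: w is alternating. *)
Definition run (c : bool) (w : seq bool) : bool :=
  sorted (fun x y => x (+) y == c) w.

#[global] Arguments run : simpl never.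

Definition openw (w : seq bool) : bool := run false w || run true w.

(** The value of [phi] on the one-letter word [b]. *)
Definition sgb (b : bool) : int := if b then 1 else -1.

Lemma run_cons2 c x y w : run c [:: x, y & w] = (x (+) y == c) && run c (y :: w).
Proof. by []. Qed.

Lemma run_rcons c x y w :
  run c (rcons (x :: w) y) = run c (x :: w) && (last x w (+) y == c).
Proof. by rewrite /run rcons_cons /= rcons_path. Qed.

Lemma run_rev c w : run c (rev w) = run c w.
Proof. by rewrite /run rev_sorted; apply: eq_sorted => x y; rewrite addbC. Qed.

Lemma run_last c x w : run c (x :: w) -> last x w = x (+) (c && odd (size w)).
Proof.
elim: w x => [|y w IHw] x; first by rewrite andbF addbF.
rewrite run_cons2 => /andP[/eqP h /IHw /= ->]; rewrite -h.
by case: x y (odd _) {h} => [] [] [].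
Qed.

(** The two words overlap in at least two letters, and the first adjacent pair of [w] decides
    between constant and alternating for both. *)
Lemma run_both x w y :
  (1 < size w)%N -> openw (x :: w) -> openw (rcons w y) ->
  exists d, run d (x :: rcons w y).
Proof.
case: w => [|a [|b w]] //= _.
rewrite /openw !run_cons2 => h1 h2; exists (a (+) b).
rewrite !run_cons2; case: (a (+) b) h1 h2 => /=;
by rewrite ?(andbF,orbF) => /andP[-> _] ->.
Qed.

Lemma run_inj c x w w' :
  size w = size w' -> run c (x :: w) -> run c (x :: w') -> w = w'.
Proof.
elim: w w' x => [|y w IHw] [|y' w'] x //= [sz].
rewrite !run_cons2 => /andP[/eqP h rw] /andP[/eqP h' rw'].
have y_eq : y' = y by move: h'; rewrite -h; case: x y y' {h rw rw'} => [] [] [].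
by rewrite y_eq in rw' *; congr (_ :: _); apply: IHw rw rw'.
Qed.

(** * The words [altT] and [altCT] as runs *)

Lemma altT_mkseq n : altT n = mkseq odd n.
Proof. by elim: n => //= n ->; rewrite mkseqS negbK. Qed.

Lemma run_altT n : run true (altT n).
Proof.
rewrite altT_mkseq; apply/(sortedP false) => i; rewrite size_mkseq => lt_in.
by rewrite !nth_mkseq ?(ltnW lt_in) //= addbN addbb.
Qed.

Lemma run_altCT n : run true (altCT n).
Proof.
rewrite /altCT /run sorted_map; apply: sub_sorted (run_altT n) => x y /=.
by rewrite addbN addNb negbK.
Qed.

(** A run is determined by its kind, length and first letter ([run_inj]), so comparison with [altT]
    reduces to conditions that are easy to follow when letters are added. *)
Lemma is_evenT_cons x w :
  is_evenT (x :: w) = [&& odd (size w), ~~ x & run true (x :: w)].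
Proof.
rewrite /is_evenT; apply/and3P/and3P => [[_ h /eqP e]|[h x0 r]].
  rewrite /= negbK in h; split => //; last by rewrite e run_altT.
  by move: e; rewrite altT_mkseq => -[->].
split; [by rewrite /=; case: (size w) h|by rewrite /= negbK|apply/eqP].
have := run_altT (size (x :: w)); move: (size_altT (size (x :: w))).
rewrite altT_mkseq (negbTE x0) in r *; rewrite /mkseq /= => -[sz] r'.
by congr (_ :: _); apply: run_inj r r'.
Qed.

Lemma is_evenCT_cons x w :
  is_evenCT (x :: w) = [&& odd (size w), x & run true (x :: w)].
Proof.
rewrite /is_evenCT; apply/and3P/and3P => [[_ h /eqP e]|[h x0 r]].
  rewrite /= negbK in h; split => //; last by rewrite e run_altCT.
  by move: e; rewrite /altCT altT_mkseq => -[->].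
split; [by rewrite /=; case: (size w) h|by rewrite /= negbK|apply/eqP].
have := run_altCT (size (x :: w)); move: (size_altCT (size (x :: w))).
rewrite /altCT altT_mkseq x0 in r *; rewrite /mkseq /= => -[sz] r'.
by congr (_ :: _); apply: run_inj r r'.
Qed.

(** * The function [xi]: reversal, runs, extension on both sides *)

Lemma xi_step x v y :
  xi (x :: rcons v y) =
    if ~~ odd (size v) && run true (x :: rcons v y) then - sgb x
    else Num.sg (xi (x :: v) + xi (rcons v y)).
Proof.
rewrite xiE // is_evenT_cons is_evenCT_cons -rcons_cons lcut_rcons /= size_rcons /=.
by case: (odd _); case: (run _ _); case: x.
Qed.

(** Reversal exchanges the two cuts, which enter symmetrically, and exchanges [altT k] with
    [altCT k] for even [k], whence the sign. *)
Lemma xi_rev w : xi (rev w) = - xi w.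
Proof.
have [n] := ubnP (size w); elim: n w => // n IHn [|x w]; first by rewrite oppr0.
case: (lastP w) => [|{}w y]; first by rewrite /rev /=; case: x.
rewrite /= size_rcons => lt_wn.
have rev_xwy : rev (x :: rcons w y) = y :: rcons (rev w) x.
  by rewrite rev_cons rev_rcons rcons_cons.
have e1 : xi (y :: rev w) = - xi (rcons w y).
  by rewrite -IHn ?rev_rcons ?size_rcons.
have e2 : xi (rcons (rev w) x) = - xi (x :: w) by rewrite -IHn ?rev_cons.
rewrite rev_xwy !xi_step -rev_xwy run_rev size_rev e1 e2 -opprD sgrN addrC.
case: ifP => // /andP[even_w] /run_last.
by rewrite last_rcons size_rcons /= even_w => ->; case: (x).
Qed.

Lemma run_belast c x w y : run c (x :: rcons w y) -> run c (x :: w).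
Proof. by rewrite -rcons_cons run_rcons => /andP[]. Qed.

Lemma run_behead c x w : run c (x :: w) -> run c w.
Proof. by case: w => // y w; rewrite run_cons2 => /andP[]. Qed.

Lemma xi_const w : run false w -> xi w = 0.
Proof.
have [n] := ubnP (size w); elim: n w => // n IHn [|x w] //.
case: (lastP w) => [|{}w y]; first by case: x.
rewrite /= size_rcons => lt_wn r; rewrite xi_step ifF.
  rewrite !IHn ?size_rcons ?addr0 //; first exact: run_behead r.
  exact: run_belast r.
apply/negbTE; rewrite negb_and orbC; apply/orP; left.
case: w r {lt_wn} => [|z w]; rewrite ?rcons_cons !run_cons2;
  by case: (_ (+) _).
Qed.

(** At odd length both cuts are alternating of even length with opposite first letters, so their
    values cancel. *)
Lemma xi_alt x w :
  run true (x :: w) -> xi (x :: w) = if odd (size w) then - sgb x else 0.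
Proof.
have [n] := ubnP (size w); elim: n x w => // n IHn x w.
case: (lastP w) => [|{}w y]; first by case: x.
rewrite /= size_rcons => lt_wn r; rewrite xi_step r andbT /=.
case: ifP => // odd_w; case: w r lt_wn odd_w => [|z w] // r lt_wn odd_w.
rewrite rcons_cons !IHn ?size_rcons //; last by exact: run_belast r.
  move: odd_w r; rewrite /= run_cons2 => /negbFE ->.
  by case: (x) (z) => [] [].
by move: r; rewrite rcons_cons run_cons2 => /andP[].
Qed.

(** Strong induction: each cut of [x v y] is again a shorter centre with two outer letters, namely a
    cut of [v] extended on both sides. The cases depend on which cuts of [v] are runs. *)
Lemma xi_extend x v y :
  xi (x :: rcons v y) = if openw v && (x != y) then sgb y else xi v.
Proof.
have [n] := ubnP (size v); elim: n x v y => // n IHn x v y.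
case: v => [|a v]; first by case: x y => [] [].
case/lastP: v => [|v b]; first by case: x a y => [] [] [].
(* [run_both] needs two letters between [a] and [b]; shorter centres are checked by enumeration. *)
case: (ltnP 1 (size v)) => [v_gt1|]; last first.
  by case: v => [|c [|]] // _ _; case: x a b y => [] [] [] [] //; case: c.
rewrite [size _]/= size_rcons => lt_vn.
(* Reversal removes the case where only the right cut of the centre is a run; when [x != y], [sgb x]
   is [- sgb y], in accordance with [xi_rev]. *)
wlog lft : x a v b y v_gt1 lt_vn / openw (a :: v) || ~~ openw (rcons v b).
  move=> H; case: (boolP (openw (a :: v) || ~~ openw (rcons v b))) => [|nlft].
    exact: H.
  have rev_avb : rev (a :: rcons v b) = b :: rcons (rev v) a.
    by rewrite rev_cons rev_rcons rcons_cons.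
  have rev_w : rev (x :: rcons (a :: rcons v b) y)
      = y :: rcons (b :: rcons (rev v) a) x.
    by rewrite rev_cons rev_rcons rcons_cons rev_avb.
  apply: oppr_inj; rewrite -xi_rev rev_w H ?size_rev //.
    rewrite -rev_avb xi_rev /openw !run_rev [y == x]eq_sym.
    by case: ifP => // /andP[_]; case: x {H rev_w} => [] //; case: y.
  apply/orP; left; move: nlft; rewrite negb_or negbK => /andP[_].
  by rewrite -rev_rcons /openw !run_rev.
have IHl z : xi (z :: a :: rcons v b) =
    if openw (a :: v) && (z != b) then sgb b else xi (a :: v).
  by rewrite -rcons_cons IHn.
have IHr z : xi (a :: rcons (rcons v b) z) =
    if openw (rcons v b) && (a != z) then sgb z else xi (rcons v b).
  by rewrite IHn // size_rcons.
rewrite xi_step IHl [rcons (_ :: _) _]rcons_cons IHr.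
case: v v_gt1 lft lt_vn IHl IHr => [|c [|e v]] // v_gt1 lft lt_vn _ _.
(* If both cuts are runs, the whole centre is one run, and every value is explicit. *)
case: (boolP (openw (rcons [:: c, e & v] b))) lft => [or|nor].
  rewrite /= orbF => ol; have [d r] := run_both _ _ _ v_gt1 ol or; rewrite ol !andTb.
  have rl := run_belast _ _ _ _ r; have rr := run_behead _ _ _ r.
  have := run_last _ _ _ r; rewrite last_rcons => eb.
  have -> : openw (a :: rcons [:: c, e & v] b).
    by rewrite /openw; case: d r {rl rr eb} => ->; rewrite ?orbT.
  case: d r rl rr eb => r rl rr eb.
    rewrite (xi_alt _ _ r) (xi_alt _ _ rl) (xi_alt _ _ rr).
    have -> : run true (x :: rcons (a :: rcons [:: c, e & v] b) y) =
        (x (+) a) && (b (+) y).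
      rewrite rcons_cons run_cons2 -rcons_cons run_rcons r last_rcons.
      by rewrite andTb; case: (_ (+) _); case: (_ (+) _).
    move: eb r; rewrite run_cons2 /= !size_rcons /= !negbK => -> /andP[+ _].
    case: (odd _); clear; case: x a c y => [] [] [] [] //=.
  rewrite (xi_const _ r) (xi_const _ rl) (xi_const _ rr).
  rewrite !run_cons2.
  move: eb r; rewrite run_cons2 /= addbF => -> /andP[+ _].
  by clear; case: x a c y => [] [] [] [] //=; rewrite ?andbF.
have nor' z : openw (z :: rcons [:: c, e & v] b) = false.
  apply/negbTE; apply: contra nor; rewrite /openw.
  by case/orP => /run_behead ->; rewrite ?orbT.
have [_ /negbTE nr] := norP nor; have [_ /negbTE nr'] := norP (negbT (nor' a)).
have -> : run true (x :: rcons (a :: rcons [:: c, e & v] b) y) = false.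
  by rewrite rcons_cons run_cons2 -rcons_cons run_rcons nr' andbF.
rewrite nor' (xi_step a) nr' !andbF.
(* If neither cut is a run, what remains is the recursion equation of [xi] at the centre itself. *)
case: (boolP (openw _)) => // ol _; rewrite andTb andFb.
case: (x =P b) => // _.
have [d r] : exists d, run d [:: a, c, e & v].
  by case/orP: ol => r; [exists false|exists true].
have := nor; rewrite {1}/openw !run_rcons.
have := run_last _ _ _ (run_behead _ _ _ r).
have ov : openw (e :: v).
  have := run_behead _ _ _ (run_behead _ _ _ r).
  by rewrite /openw; case: d {r} => ->; rewrite ?orbT.
have lt_v : (size (e :: v) < n)%N by move: lt_vn => /=; lia.
rewrite rcons_cons IHn // ov.
(* As [b] breaks the run, [xi] is [sgb b] on the right cut and [0] or [sgb b] on the left one;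
   replacing the latter by [sgb b] keeps the sign of the sum. *)
case: d r => r.
  rewrite (xi_alt _ _ r) (xi_alt _ _ (run_behead _ _ _ (run_behead _ _ _ r))).
  move=> ->; rewrite negb_or (run_behead _ _ _ r) => /andP[_].
  move: r; rewrite !run_cons2 /= => /and3P[+ + _].
  by case: (odd _); clear; case: a b c e => [] [] [] [].
move=> ->; rewrite negb_or (run_behead _ _ _ r) => /andP[+ _].
rewrite (xi_const _ r) (xi_const _ (run_behead _ _ _ (run_behead _ _ _ r))).
move: r; rewrite !run_cons2 /= => /and3P[+ + _].
by clear; case: a b c e => [] [] [] [].
Qed.

(** * The function [phi]: reversal, constant words, extension on both sides *)

Lemma run_nseq n b : run false (nseq n b).
Proof. by elim: n => [|[|n] IHn] //; rewrite run_cons2 addbb. Qed.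

Lemma run_false_nseq x w : run false (x :: w) = (x :: w == nseq (size w).+1 x).
Proof.
apply/idP/eqP => [r|->]; last exact: run_nseq.
by congr (_ :: _); apply: run_inj r (run_nseq (size w).+1 x); rewrite size_nseq.
Qed.

Lemma phi_step x v y :
  phi (x :: rcons v y) =
    if odd (size v) && run false (x :: rcons v y) then sgb x
    else Num.sg (phi (rcons v y) - phi (x :: v)).
Proof.
rewrite phiE // run_false_nseq -[in lcut _]rcons_cons lcut_rcons.
rewrite /is_odd0 /is_odd1 /= size_rcons /= negbK.
by case: (odd _) => //; case: x => /=; rewrite ?eqseq_cons ?eqxx.
Qed.

(** Exchanging the cuts negates their difference; if the cuts have even length, each changes sign as
    well and the two effects cancel. *)
Lemma phi_rev w : phi (rev w) = if odd (size w) then phi w else - phi w.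
Proof.
have [n] := ubnP (size w); elim: n w => // n IHn [|x w]; first by rewrite oppr0.
case: (lastP w) => [|{}w y]; first by rewrite /rev /=; case: x.
rewrite /= size_rcons /= negbK => lt_wn.
have rev_xwy : rev (x :: rcons w y) = y :: rcons (rev w) x.
  by rewrite rev_cons rev_rcons rcons_cons.
have := IHn (rcons w y); rewrite rev_rcons size_rcons => /(_ lt_wn) e1.
have := IHn (x :: w); rewrite rev_cons /= => /(_ lt_wn) e2.
rewrite rev_xwy !phi_step -rev_xwy run_rev size_rev e1 e2 /=.
case: (odd (size w)) => /=; last by rewrite -sgrN opprB.
case: ifP => [/run_last|_]; last by rewrite opprK addrC.
by rewrite last_rcons /= addbF => ->.
Qed.

Lemma phi_const x w :
  run false (x :: w) -> phi (x :: w) = if odd (size w) then 0 else sgb x.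
Proof.
have [n] := ubnP (size w); elim: n x w => // n IHn x w.
case: (lastP w) => [|{}w y]; first by case: x.
rewrite /= size_rcons => lt_wn r; rewrite phi_step r andbT /=.
case: ifP => // odd_w; case: w r lt_wn odd_w => [|z w] r lt_wn odd_w.
  by move: r; rewrite run_cons2 /=; case: (x) (y) => [] [].
rewrite rcons_cons !IHn ?size_rcons //; last 1 first.
- by move: r; rewrite rcons_cons run_cons2 => /andP[].
- move: odd_w r; rewrite /= run_cons2 => ->.
  by case: (x) (z) => [] [].
exact: run_belast r.
Qed.

(** Same scheme as for [xi_extend], but only constant centres are exceptional: alternating ones of
    length at least 2 obey the general rule [- phi v]. *)
Lemma phi_extend x v y :
  phi (x :: rcons v y) =
    if run false v then
      if odd (size v) then
        if run false (x :: rcons v y) then phi v else - phi v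
      else if x == y then 0 else sgb y
    else - phi v.
Proof.
have [n] := ubnP (size v); elim: n x v y => // n IHn x v y.
case: v => [|a v]; first by case: x y => [] [].
case/lastP: v => [|v b]; first by case: x a y => [] [] [].
case: v => [|c v]; first by case: x a b y => [] [] [] [].
rewrite [size _]/= size_rcons => lt_vn.
wlog lft : x a c v b y lt_vn /
    run false [:: a, c & v] || ~~ run false (rcons (c :: v) b).
  move=> H; case: (boolP (run false [:: a, c & v] ||
                          ~~ run false (rcons (c :: v) b))) => [|nlft].
    exact: H.
  have rev_avb : rev (a :: rcons (c :: v) b) = b :: rcons (rev (c :: v)) a.
    by rewrite rev_cons rev_rcons rcons_cons.
  have rev_w : rev (x :: rcons (a :: rcons (c :: v) b) y)
      = y :: rcons (b :: rcons (rev (c :: v)) a) x.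
    by rewrite rev_cons rev_rcons rcons_cons rev_avb.
  have := phi_rev (x :: rcons (a :: rcons (c :: v) b) y).
  have [c' [v' ev]] : exists c' v', rev (c :: v) = c' :: v'.
    by case: (rev (c :: v)) (size_rev (c :: v)) => // c' v'; exists c', v'.
  have [sv] : size (c' :: v') = size (c :: v) by rewrite -ev size_rev.
  rewrite rev_w ev H -?ev ?sv //.
    rewrite -rev_w -rev_avb !run_rev !phi_rev [y == x]eq_sym.
    rewrite /= !size_rcons /= ?size_rcons /= !negbK.
    case: (odd _) => /= [|<- //]; move=> e; rewrite -[LHS]opprK -e.
    by case: ifP => _; rewrite ?opprK //; clear; case: x y => [] [].
  apply/orP; left; move: nlft; rewrite negb_or negbK => /andP[_].
  by rewrite -rev_rcons !run_rev.
(* The double negation is the parity of the shortened centre, reduced to that of [v]. *)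
have IHl z : phi (z :: a :: rcons (c :: v) b) =
    if run false [:: a, c & v] then
      if ~~ ~~ odd (size v) then
        if run false (z :: a :: rcons (c :: v) b) then phi [:: a, c & v]
        else - phi [:: a, c & v]
      else if z == b then 0 else sgb b
    else - phi [:: a, c & v].
  by rewrite -rcons_cons IHn.
have IHr z : phi (a :: rcons (rcons (c :: v) b) z) =
    if run false (rcons (c :: v) b) then
      if ~~ ~~ odd (size v) then
        if run false (a :: rcons (rcons (c :: v) b) z)
        then phi (rcons (c :: v) b)
        else - phi (rcons (c :: v) b)
      else if a == z then 0 else sgb z
    else - phi (rcons (c :: v) b).
  by rewrite IHn /= size_rcons.
rewrite phi_step IHl [rcons (a :: _) _]rcons_cons IHr.
case: (boolP (run false (rcons (c :: v) b))) lft => [rr|nrr].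
  rewrite orbF => rl; rewrite rl.
  have r : run false (a :: rcons (c :: v) b).
    by move: rl; rewrite rcons_cons run_cons2 => /andP[h _]; rewrite run_cons2 h.
  rewrite r (phi_const _ _ r) (phi_const _ _ rl) (phi_const _ _ rr).
  have -> : run false (x :: a :: rcons (c :: v) b) = ~~ (x (+) a).
    by rewrite run_cons2 r andbT; case: (_ (+) _).
  have -> : run false (x :: a :: rcons (rcons (c :: v) b) y) =
      ~~ (x (+) a) && ~~ (b (+) y).
    rewrite run_cons2 -rcons_cons run_rcons r last_rcons andTb.
    by case: (_ (+) _); case: (_ (+) _).
  have -> : run false (a :: rcons (rcons (c :: v) b) y) = ~~ (b (+) y).
    rewrite -rcons_cons run_rcons r last_rcons andTb.
    by case: (_ (+) _).
  have := run_last _ _ _ r; rewrite last_rcons addbF => ->.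
  move: r; rewrite run_cons2 /= size_rcons /= => /andP[+ _].
  by case: (odd _); clear; case: x a c y => [] [] [] [].
have nr z : run false (z :: rcons (c :: v) b) = false.
  by apply/negbTE; apply: contra nrr => /run_behead.
have -> : run false (x :: a :: rcons (rcons (c :: v) b) y) = false.
  by rewrite run_cons2 -rcons_cons run_rcons nr andbF.
have -> : run false (x :: a :: rcons (c :: v) b) = false.
  by rewrite run_cons2 nr andbF.
rewrite !nr (phi_step a) nr !andbF.
case: (boolP (run false [:: a, c & v])) => rl _; last first.
  by rewrite -sgrN opprB opprK addrC.
have lt_v : (size v < n)%N by move: lt_vn => /=; lia.
have ca : c = a by move: rl; rewrite run_cons2; clear; case: a c => [] [].
have rv := run_behead _ _ _ rl.
have ba : b = ~~ a.
  move: nrr; rewrite run_rcons rv (run_last _ _ _ rv) ca addbF; clear.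
  by case: a b => [] [].
have -> : phi (rcons (c :: v) b) = sgb b.
  rewrite rcons_cons IHn // (run_behead _ _ _ rv) -rcons_cons (negbTE nrr).
  case: ifP => [|_]; last by rewrite ca ba; case: (a).
  case: v rv {lt_vn IHl IHr nrr nr rl lt_v} => [|e v] //.
  rewrite run_cons2 => /andP[ce /phi_const ->]; rewrite /= => /negbTE ->.
  by move: ce; rewrite ca ba; clear; case: a e => [] [].
(* The cut starting with [x] has value [0] or [sgb b], the other one [- sgb b], so the difference
   has sign [- sgb b] for every [x] and [y]. *)
rewrite (phi_const _ _ rl) ba /=; case: (odd _); clear; by case: x a => [] [].
Qed.

(** * Zeros of [psi] and colourability *)

Lemma phi_odd_neq0 w : odd (size w) -> phi w != 0.
Proof.
have [n] := ubnP (size w); elim: n w => // n IHn [|x w] //.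
case/lastP: w => [|w y]; first by case: x.
rewrite /= size_rcons /= negbK => lt_wn odd_w; rewrite phi_extend odd_w.
have phi_w : phi w != 0 by apply: IHn => //; exact: ltnW.
by do 2?case: ifP => // _; rewrite oppr_eq0.
Qed.

(** On a constant centre of even length both extensions vanish exactly when [x == y]. On a nonempty
    alternating one [xi] is nonzero in either branch, so the induction hypothesis still decides. *)
Lemma xi_phi_eq0 w : ~~ odd (size w) -> (xi w == 0) = (phi w == 0).
Proof.
have [n] := ubnP (size w); elim: n w => // n IHn [|x w] //.
case/lastP: w => [|w y]; first by case: x.
rewrite /= size_rcons /= negbK => lt_wn even_w.
rewrite phi_extend xi_extend (negbTE even_w) /openw.
have IHw := IHn w (ltnW lt_wn) even_w.
case: (boolP (run false w)) => [rw|nrw] /=.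
  by rewrite (xi_const _ rw); case: (x) (y) => [] [].
rewrite oppr_eq0 -IHw; case: ifP => // /andP[rw _].
case: w {lt_wn IHw} nrw rw even_w => // z w _ /xi_alt ->.
by rewrite /= negbK => ->; case: z y => [] [].
Qed.

(** At odd length [phi] never vanishes; at even length it vanishes together with [xi]. *)
Lemma colourableE w : w != [::] -> colourable w = (xi w != 0).
Proof.
case: w => // x w _; rewrite /colourable /psi mulf_eq0 expf_eq0 /=.
case: (boolP (odd (size (x :: w)))) => [o|e].
  by rewrite (negbTE (phi_odd_neq0 _ o)) orbF.
by rewrite -xi_phi_eq0 // orbb.
Qed.

(* The non-colourable words among the constant and alternating ones. *)
Definition symrun (w : seq bool) : bool :=
  run false w || odd (size w) && run true w.

Lemma colourable_symrun w : symrun w -> colourable w = false.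
Proof.
case: w => // x w; rewrite /symrun colourableE // => /orP[/xi_const ->//|].
by move=> /andP[/= /negbTE e /xi_alt ->]; rewrite e.
Qed.

(** Nonempty alternating words of even length are not exceptional here: [xi] is nonzero on them and
    on all their extensions. *)
Lemma colourable_extend x v y :
  colourable (x :: rcons v y) = if symrun v then x != y else colourable v.
Proof.
case: v => [|a v]; first by case: x y => [] [].
rewrite !colourableE // xi_extend /symrun /openw.
case: (boolP (run false _)) => [r|nr] /=.
  by rewrite (xi_const _ r); case: (x) (y) => [] [].
case: (boolP (run true _)) => r /=; rewrite ?andbF // (xi_alt _ _ r).
by case: (odd _); case: (a) (x) (y) => [] [] [].
Qed.

(** * Splitting letters off sums over words; summands are functions of sequences, which avoids tuple
    casts *)

Lemma sum_tuple0 (F : seq bool -> nat) :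
  (\sum_(w : 0.-tuple bool) F w = F [::])%N.
Proof. by rewrite (big_pred1 [tuple]) // => w; rewrite [w]tuple0 /= eqxx. Qed.

Lemma sum_tuple_cons m (F : seq bool -> nat) :
  (\sum_(w : m.+1.-tuple bool) F w =
   \sum_x \sum_(v : m.-tuple bool) F (x :: v))%N.
Proof.
rewrite pair_big /=.
rewrite (reindex (fun p : bool * m.-tuple bool => [tuple of p.1 :: p.2])) //=.
exists (fun w : m.+1.-tuple bool => (thead w, [tuple of behead w]))
  => [[x v] _|w _] /=.
  by congr (_, _); apply: val_inj.
by rewrite [RHS]tuple_eta.
Qed.

Lemma sum_tuple_rev m (F : seq bool -> nat) :
  (\sum_(w : m.-tuple bool) F w = \sum_(w : m.-tuple bool) F (rev w))%N.
Proof.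
rewrite (reindex (fun w : m.-tuple bool => [tuple of rev w])) //=.
by exists (fun w : m.-tuple bool => [tuple of rev w]) => w _;
  apply: val_inj; rewrite /= revK.
Qed.

Lemma sum_tuple_rcons m (F : seq bool -> nat) :
  (\sum_(w : m.+1.-tuple bool) F w =
   \sum_y \sum_(v : m.-tuple bool) F (rcons v y))%N.
Proof.
rewrite sum_tuple_rev (sum_tuple_cons _ (fun w => F (rev w))); apply: eq_bigr => y _.
rewrite (sum_tuple_rev _ (fun v => F (rev (y :: v)))); apply: eq_bigr => v _.
by rewrite rev_cons revK.
Qed.

(** * The recurrence for [K] and its initial values *)

Lemma K_sum m : K m = (\sum_(w : m.-tuple bool) ~~ colourable w)%N.
Proof. by rewrite /K cardsE -sum1_card big_mkcond /=. Qed.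

(** A [symrun] centre is non-colourable and so are exactly two of its four extensions; for any other
    centre all four share its status. The correction stands on the left to avoid truncated
    subtraction. *)
Lemma K_rec m :
  (K m.+2 + 2 * \sum_(v : m.-tuple bool) symrun v = 4 * K m)%N.
Proof.
rewrite !K_sum (sum_tuple_cons _ (fun w => nat_of_bool (~~ colourable w))).
under eq_bigr do
  rewrite (sum_tuple_rcons _ (fun v => nat_of_bool (~~ colourable (_ :: v)))).
rewrite !big_bool -!big_split !big_distrr -big_split; apply: eq_bigr => v _ /=.
rewrite !colourable_extend; case: ifP => [/colourable_symrun ->//|_].
by case: (colourable v).
Qed.

(** Exactly one letter put in front prolongs a nonempty run, so the count stays that of one-letter
    words. *)
Lemma sum_run c m : (\sum_(v : m.+1.-tuple bool) run c v = 2)%N.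
Proof.
elim: m => [|m IHm].
  rewrite (sum_tuple_cons _ (fun w => nat_of_bool (run c w))) big_bool.
  by rewrite !(sum_tuple0 (fun v => nat_of_bool (run c (_ :: v)))).
rewrite -IHm (sum_tuple_cons _ (fun w => nat_of_bool (run c w))) exchange_big /=.
apply: eq_bigr => v _.
rewrite big_bool /=; case: (tval v) (size_tuple v) => [|x u] // _.
by rewrite /= !run_cons2; case: (x) (c) => [] []; rewrite /= ?addn0.
Qed.

(** From length 2 on no word is both constant and alternating, so the two counts add up; lengths 0
    and 1 are treated separately. *)
Lemma sum_symrun m :
  (\sum_(v : m.+2.-tuple bool) symrun v = if odd m then 4 else 2)%N.
Proof.
case: (boolP (odd m)) => om.
  rewrite -[RHS]/(2 + 2)%N -{1}(sum_run false m.+1) -(sum_run true m.+1).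
  rewrite -big_split.
  apply: eq_bigr => v _ /=; rewrite /symrun size_tuple /= negbK om.
  case: (tval v) (size_tuple v) => [|x [|y u]] // _; rewrite /= !run_cons2.
  by case: (x (+) y); rewrite ?orbF ?addn0.
rewrite -(sum_run false m.+1); apply: eq_bigr => v _.
by rewrite /symrun size_tuple /= negbK (negbTE om) orbF.
Qed.

Lemma sum_symrun0 : (\sum_(v : 0.-tuple bool) symrun v = 1)%N.
Proof. by rewrite (sum_tuple0 (fun v => nat_of_bool (symrun v))). Qed.

Lemma sum_symrun1 : (\sum_(v : 1.-tuple bool) symrun v = 2)%N.
Proof.
rewrite -(sum_run false 0); apply: eq_bigr => v _.
by case: (tval v) (size_tuple v) => [|x [|]].
Qed.

Lemma K0 : K 0 = 1%N.
Proof. by rewrite K_sum (sum_tuple0 (fun w => nat_of_bool (~~ colourable w))). Qed.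

Lemma K1 : K 1 = 2%N.
Proof.
rewrite K_sum (sum_tuple_cons _ (fun w => nat_of_bool (~~ colourable w))).
rewrite big_bool.
by rewrite !(sum_tuple0 (fun v => nat_of_bool (~~ colourable (_ :: v)))).
Qed.

Lemma K2 : K 2 = 2%N.
Proof. have := K_rec 0; rewrite K0 sum_symrun0; lia. Qed.

Lemma K3 : K 3 = 4%N.
Proof. have := K_rec 1; rewrite K1 sum_symrun1; lia. Qed.

Theorem theorem6p6 (n : nat) : ((K (n + 2)%N)%:R : rat) = 2 * (J n + 1).
Proof.
rewrite addn2.
(* The recurrence advances by two, hence two base cases. *)
elim/ltn_ind: n => -[|[|n]] IHn.
- by rewrite K2.
- by rewrite K3.
have := K_rec n.+2; rewrite sum_symrun => /(congr1 (fun k => k%:R : rat)).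
rewrite natrD !natrM (IHn n) // /J !exprS.
(* With [3 - (-1) ^+ n] for the number of exceptional centres, the goal is linear in [2 ^+ n] and
   [(-1) ^+ n]. *)
have -> : (2 * (if odd n then 4 else 2)%N%:R : rat) = 6 - 2 * (-1) ^+ n.
  by rewrite -signr_odd; case: (odd n).
lra.
Qed.
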